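(* Let $S$ be a bipotent semiring, let $a \in S$, and let $\langle a \rangle$ be the monogenic subsemiring of $S$ generated by $a$. Then, as semirings, \[\langle a \rangle \cong \begin{cases} \mathbb{N}_{\max} &\text{ if } a \text{ has infinite order and } a < a^2; \\ (-\mathbb{N})_{\max} &\text{ if } a \text{ has infinite order and } a^2 < a; \\ [k]_{\max} &\text{ if } a \text{ has order } k \in \mathbb{N} \text{ and } a \leq a^2; \\ [-k]_{\max} &\text{ if } a \text{ has order } k \in \mathbb{N} \text{ and } a^2 \leq a. \end{cases}\]
   Context: $\mathbb{N}$ denotes the natural numbers excluding $0$. A semiring is a non-empty set with two associative binary operations (addition and multiplication), with addition commutative and multiplication distributing over addition on both sides; no zero or identity element is required. It is bipotent if $x+y\in\{x,y\}$ for all $x,y$; a bipotent semiring is linearly ordered by $x \leq y \iff x+y=y$. A subsemiring is a subset closed under addition and multiplication. $\langle a\rangle$ is the intersection of all subsemirings containing $a$. The (multiplicative) order of $a$ is the cardinality of the set $\{a^i : i \in \mathbb{N}\}$ of positive powers of $a$. $\mathbb{N}_{\max}$ is the semiring on $\mathbb{N}$ whose addition is maximum and whose multiplication is classical addition. $(-\mathbb{N})_{\max}$ is the semiring on the negative integers $\{-1,-2,\dots\}$ whose addition is maximum and whose multiplication is classical addition. For $k\in\mathbb{N}$, $[k]_{\max}$ is the semiring on $\{1,\dots,k\}$ whose addition is maximum and whose multiplication is $(a,b)\mapsto\min(a+b,k)$, and $[-k]_{\max}$ is the semiring on $\{-k,\dots,-1\}$ whose addition is maximum and whose multiplication is $(a,b)\mapsto\max(a+b,-k)$,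 where $+$ is classical addition. *)

(* Defs.v *)
From HB Require Import structures.
From mathcomp Require Import all_boot all_order all_algebra.
From mathcomp Require Import zify.
From mathcomp Require Import boolp classical_sets functions cardinality.

Set Implicit Arguments.
Unset Strict Implicit.
Unset Printing Implicit Defensive.

Import Order.TTheory GRing.Theory Num.Theory.

Local Open Scope classical_set_scope.
Local Open Scope card_scope.

(* Semirings without zero or identity. Addition is [(x + y)%R] and
   multiplication is [(x * y)%g], from MathComp's semigroup structures;
   [addSemigroupType] includes commutativity of addition. *)
HB.mixin Record isSemiring S of Algebra.AddSemigroup S & Semigroup S := {
  semiring_nonempty : exists x : S, True;
  semiring_mulDl : left_distributive (@monoid.mul S) (@Algebra.add S);
  semiring_mulDr : right_distributive (@monoid.mul S) (@Algebra.add S)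
}.

#[short(type="semiringType")]
HB.structure Definition Semiring :=
  {S of isSemiring S & Algebra.AddSemigroup S & Semigroup S}.

Definition bipotent (S : semiringType) :=
  forall x y : S, (x + y)%R = x \/ (x + y)%R = y.

Definition sr_le (S : semiringType) (x y : S) := (x + y)%R = y.

Definition sr_lt (S : semiringType) (x y : S) := sr_le x y /\ x <> y.

Definition subsemiring (S : semiringType) (A : set S) :=
  (forall x y, A x -> A y -> A (x + y)%R) /\
  (forall x y, A x -> A y -> A (x * y)%g).

Definition semiring_iso (S T : semiringType) :=
  exists f : S -> T, [/\ bijective f,
    {morph f : x y / (x + y)%R >-> (x + y)%R} &
    {morph f : x y / (x * y)%g >-> (x * y)%g}].

(* [a * (a * ... * a)] with [i] factors when [0 < i]; the value at [i = 0] is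
   junk, there being no identity element. *)
Definition sr_pow (S : semiringType) (a : S) (i : nat) : S :=
  iterop i (@monoid.mul S) a a.

Definition powers (S : semiringType) (a : S) : set S :=
  [set sr_pow a i | i in [set i | (0 < i)%N]].

Definition has_infinite_order (S : semiringType) (a : S) :=
  infinite_set (powers a).

Definition has_order (S : semiringType) (a : S) (k : nat) :=
  powers a #= `I_k.

Section Monogenic.
Variables (S : semiringType) (a : S).

Definition monogenic : set S := smallest (@subsemiring S) [set a].

Lemma monogenic_gen : monogenic a.
Proof. exact: sub_gen_smallest. Qed.

Lemma monogenic_subsemiring : subsemiring monogenic.
Proof.
split=> x y Ax Ay B sB; have [Bx By] := (Ax B sB, Ay B sB).
  exact: sB.1.1.
exact: sB.1.2.
Qed.

Definition monogenic_sr : Type := set_type monogenic.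

HB.instance Definition _ := [isSub of monogenic_sr for @sval _ _].
HB.instance Definition _ := [Choice of monogenic_sr by <:].

Definition monogenic_add (x y : monogenic_sr) : monogenic_sr :=
  exist _ (val x + val y)%R
    (mem_set (monogenic_subsemiring.1 (val x) (val y)
                (set_mem (valP x)) (set_mem (valP y)))).

Definition monogenic_mul (x y : monogenic_sr) : monogenic_sr :=
  exist _ (val x * val y)%g
    (mem_set (monogenic_subsemiring.2 (val x) (val y)
                (set_mem (valP x)) (set_mem (valP y)))).

Fact monogenic_addC : commutative monogenic_add.
Proof. by move=> x y; apply: val_inj; exact: Algebra.addrC. Qed.
Fact monogenic_addA : associative monogenic_add.
Proof. by move=> x y z; apply: val_inj; exact: Algebra.addrA. Qed.
Fact monogenic_mulA : associative monogenic_mul.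
Proof. by move=> x y z; apply: val_inj; exact: mulgA. Qed.
Fact monogenic_mulDl : left_distributive monogenic_mul monogenic_add.
Proof. by move=> x y z; apply: val_inj; exact: semiring_mulDl. Qed.
Fact monogenic_mulDr : right_distributive monogenic_mul monogenic_add.
Proof. by move=> x y z; apply: val_inj; exact: semiring_mulDr. Qed.
Fact monogenic_nonempty : exists x : monogenic_sr, True.
Proof. by exists (exist _ a (mem_set monogenic_gen)). Qed.

HB.instance Definition _ :=
  Algebra.isAddSemigroup.Build monogenic_sr monogenic_addC monogenic_addA.
HB.instance Definition _ := isSemigroup.Build monogenic_sr monogenic_mulA.
HB.instance Definition _ := isSemiring.Build monogenic_sr
  monogenic_nonempty monogenic_mulDl monogenic_mulDr.

End Monogenic.

Definition posnat : Type := {n : nat | (0 < n)%N}.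
Coercion nat_of_posnat (k : posnat) : nat := sval k.

Section NMax.

Definition Nmax : Type := {n : nat | (0 < n)%N}.

HB.instance Definition _ := [isSub of Nmax for @sval _ _].
HB.instance Definition _ := [Choice of Nmax by <:].

Fact Nmax_add_subproof (x y : Nmax) : (0 < maxn (val x) (val y))%N.
Proof. by case: x y => [x /= hx] [y /= hy]; lia. Qed.
Fact Nmax_mul_subproof (x y : Nmax) : (0 < val x + val y)%N.
Proof. by case: x y => [x /= hx] [y /= hy]; lia. Qed.

Definition Nmax_add (x y : Nmax) : Nmax :=
  exist (fun n => (0 < n)%N) (maxn (val x) (val y)) (Nmax_add_subproof x y).
Definition Nmax_mul (x y : Nmax) : Nmax :=
  exist (fun n => (0 < n)%N) (val x + val y)%N (Nmax_mul_subproof x y).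

Fact Nmax_addC : commutative Nmax_add.
Proof. by move=> x y; apply: val_inj => /=; lia. Qed.
Fact Nmax_addA : associative Nmax_add.
Proof. by move=> x y z; apply: val_inj => /=; lia. Qed.
Fact Nmax_mulA : associative Nmax_mul.
Proof. by move=> x y z; apply: val_inj => /=; lia. Qed.
Fact Nmax_mulDl : left_distributive Nmax_mul Nmax_add.
Proof. by move=> x y z; apply: val_inj => /=; lia. Qed.
Fact Nmax_mulDr : right_distributive Nmax_mul Nmax_add.
Proof. by move=> x y z; apply: val_inj => /=; lia. Qed.
Fact Nmax_nonempty : exists x : Nmax, True.
Proof. by exists (exist _ 1%N isT). Qed.

HB.instance Definition _ := Algebra.isAddSemigroup.Build Nmax Nmax_addC Nmax_addA.
HB.instance Definition _ := isSemigroup.Build Nmax Nmax_mulA.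
HB.instance Definition _ := isSemiring.Build Nmax
  Nmax_nonempty Nmax_mulDl Nmax_mulDr.

End NMax.

Section NegNMax.
Local Open Scope ring_scope.

Definition negNmax : Type := {z : int | z < 0}.

HB.instance Definition _ := [isSub of negNmax for @sval _ _].
HB.instance Definition _ := [Choice of negNmax by <:].

Fact negNmax_add_subproof (x y : negNmax) : Num.max (val x) (val y) < 0.
Proof. by case: x y => [x /= hx] [y /= hy]; lia. Qed.
Fact negNmax_mul_subproof (x y : negNmax) : val x + val y < 0.
Proof. by case: x y => [x /= hx] [y /= hy]; lia. Qed.

Definition negNmax_add (x y : negNmax) : negNmax :=
  exist (fun z : int => z < 0) (Num.max (val x) (val y))
    (negNmax_add_subproof x y).
Definition negNmax_mul (x y : negNmax) : negNmax :=
  exist (fun z : int => z < 0) (val x + val y) (negNmax_mul_subproof x y).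

Fact negNmax_addC : commutative negNmax_add.
Proof. by move=> x y; apply: val_inj => /=; lia. Qed.
Fact negNmax_addA : associative negNmax_add.
Proof. by move=> x y z; apply: val_inj => /=; lia. Qed.
Fact negNmax_mulA : associative negNmax_mul.
Proof. by move=> x y z; apply: val_inj => /=; lia. Qed.
Fact negNmax_mulDl : left_distributive negNmax_mul negNmax_add.
Proof. by move=> x y z; apply: val_inj => /=; lia. Qed.
Fact negNmax_mulDr : right_distributive negNmax_mul negNmax_add.
Proof. by move=> x y z; apply: val_inj => /=; lia. Qed.
Fact negNmax_nonempty : exists x : negNmax, True.
Proof. by exists (exist _ (- 1) isT). Qed.

HB.instance Definition _ :=
  Algebra.isAddSemigroup.Build negNmax negNmax_addC negNmax_addA.
HB.instance Definition _ := isSemigroup.Build negNmax negNmax_mulA.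
HB.instance Definition _ := isSemiring.Build negNmax
  negNmax_nonempty negNmax_mulDl negNmax_mulDr.

End NegNMax.

Section SegMax.
Variable k : posnat.

Definition segmax : Type := {n : nat | (0 < n <= k)%N}.

HB.instance Definition _ := [isSub of segmax for @sval _ _].
HB.instance Definition _ := [Choice of segmax by <:].

Fact segmax_add_subproof (x y : segmax) : (0 < maxn (val x) (val y) <= k)%N.
Proof. by case: x y => [x /= hx] [y /= hy]; lia. Qed.
Fact segmax_mul_subproof (x y : segmax) : (0 < minn (val x + val y) k <= k)%N.
Proof. by case: x y => [x /= hx] [y /= hy]; lia. Qed.

Definition segmax_add (x y : segmax) : segmax :=
  exist (fun n => (0 < n <= k)%N) (maxn (val x) (val y))
    (segmax_add_subproof x y).
Definition segmax_mul (x y : segmax) : segmax :=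
  exist (fun n => (0 < n <= k)%N) (minn (val x + val y) k)
    (segmax_mul_subproof x y).

Fact segmax_addC : commutative segmax_add.
Proof. by move=> x y; apply: val_inj => /=; lia. Qed.
Fact segmax_addA : associative segmax_add.
Proof. by move=> x y z; apply: val_inj => /=; lia. Qed.
Fact segmax_mulA : associative segmax_mul.
Proof. by move=> x y z; apply: val_inj => /=; lia. Qed.
Fact segmax_mulDl : left_distributive segmax_mul segmax_add.
Proof. by move=> x y z; apply: val_inj => /=; lia. Qed.
Fact segmax_mulDr : right_distributive segmax_mul segmax_add.
Proof. by move=> x y z; apply: val_inj => /=; lia. Qed.
Fact segmax_nonempty : exists x : segmax, True.
Proof.
have h : (0 < 1 <= k)%N by exact: svalP k.
by exists (exist _ 1%N h).
Qed.

HB.instance Definition _ :=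
  Algebra.isAddSemigroup.Build segmax segmax_addC segmax_addA.
HB.instance Definition _ := isSemigroup.Build segmax segmax_mulA.
HB.instance Definition _ := isSemiring.Build segmax
  segmax_nonempty segmax_mulDl segmax_mulDr.

End SegMax.

Section NegSegMax.
Local Open Scope ring_scope.
Variable k : posnat.

Definition negsegmax : Type := {z : int | - k%:Z <= z < 0}.

HB.instance Definition _ := [isSub of negsegmax for @sval _ _].
HB.instance Definition _ := [Choice of negsegmax by <:].

Fact negsegmax_add_subproof (x y : negsegmax) :
  - k%:Z <= Num.max (val x) (val y) < 0.
Proof. by case: x y => [x /= hx] [y /= hy]; lia. Qed.
Fact negsegmax_mul_subproof (x y : negsegmax) :
  - k%:Z <= Num.max (val x + val y) (- k%:Z) < 0.
Proof. by case: x y => [x /= hx] [y /= hy]; lia. Qed.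

Definition negsegmax_add (x y : negsegmax) : negsegmax :=
  exist (fun z : int => - k%:Z <= z < 0)
    (Num.max (val x) (val y))
    (negsegmax_add_subproof x y).
Definition negsegmax_mul (x y : negsegmax) : negsegmax :=
  exist (fun z : int => - k%:Z <= z < 0)
    (Num.max (val x + val y) (- k%:Z))
    (negsegmax_mul_subproof x y).

Fact negsegmax_addC : commutative negsegmax_add.
Proof. by move=> x y; apply: val_inj => /=; lia. Qed.
Fact negsegmax_addA : associative negsegmax_add.
Proof. by move=> x y z; apply: val_inj => /=; lia. Qed.
Fact negsegmax_mulA : associative negsegmax_mul.
Proof. by move=> [x hx] [y hy] [z hz]; apply: val_inj => /=; lia. Qed.
Fact negsegmax_mulDl : left_distributive negsegmax_mul negsegmax_add.
Proof. by move=> x y z; apply: val_inj => /=; lia. Qed.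
Fact negsegmax_mulDr : right_distributive negsegmax_mul negsegmax_add.
Proof. by move=> x y z; apply: val_inj => /=; lia. Qed.
Fact negsegmax_nonempty : exists x : negsegmax, True.
Proof.
have h : - k%:Z <= (- 1 : int) < 0.
  by have : (0 < k)%N := svalP k; lia.
by exists (exist _ (- 1) h).
Qed.

HB.instance Definition _ :=
  Algebra.isAddSemigroup.Build negsegmax negsegmax_addC negsegmax_addA.
HB.instance Definition _ := isSemigroup.Build negsegmax negsegmax_mulA.
HB.instance Definition _ := isSemiring.Build negsegmax
  negsegmax_nonempty negsegmax_mulDl negsegmax_mulDr.

End NegSegMax.

(* Main.v *)
Require Import Defs.
From HB Require Import structures.
From mathcomp Require Import all_boot all_order all_algebra.
From mathcomp Require Import zify.
From mathcomp Require Import boolp classical_sets functions cardinality.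

(** The sum of two powers of [a] is again a power of [a]: multiplying a
    comparison between [a] and [a^2] by powers of [a] shows that the sequence
    [a, a^2, a^3, ...] is monotone, so addition acts on exponents as [max] when
    [a <= a^2] ([sr_pow_add_max]) and as [min] when [a^2 <= a]
    ([sr_pow_add_min]), while multiplication acts as addition of exponents
    ([sr_powD]).

    It remains to see which exponents give the same power. In a monotone
    sequence, [a^m = a^n] with [m < n] squeezes [a^m.+1] between two equal
    elements, so [a^m = a^m.+1] ([collapsing_of_order]), and multiplying by [a]
    makes the sequence constant from [m] on ([sr_pow_stable]). Hence either all
    powers are distinct, or the sequence takes distinct values up to some [m]
    and is constant from there; in the latter case the number of powers is [m],
    so [m] is the order of [a] ([infinite_order_inj], [finite_order_pow]).

    Each model semiring [T] is then compared with [<a>] through the map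
    [T -> S] sending an element with absolute value [i] to [a^i]. It is an
    injective morphism whose image consists of powers of [a], and its image is
    a subsemiring containing [a], hence is all of [<a>]
    ([monogenic_iso_of_embedding]). *)

Set Implicit Arguments.
Unset Strict Implicit.
Unset Printing Implicit Defensive.

Local Open Scope classical_set_scope.
Local Open Scope card_scope.

Section Powers.
Variables (S : semiringType) (a : S).
Local Notation p := (sr_pow a).

Lemma sr_powS i : 0 < i -> p i.+1 = (a * p i)%g.
Proof. by case: i. Qed.

Lemma sr_powD i j : 0 < i -> 0 < j -> p (i + j) = (p i * p j)%g.
Proof.
move=> i0 j0; elim: i i0 => // -[|i] IHi _; first by rewrite add1n sr_powS.
by rewrite addSn sr_powS // IHi // (@sr_powS i.+1) // mulgA.
Qed.

Lemma monogenic_pow i : 0 < i -> monogenic a (p i).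
Proof.
elim: i => // -[|i] IHi _; first exact: monogenic_gen.
rewrite sr_powS //.
apply: (monogenic_subsemiring a).2; [exact: monogenic_gen|exact: IHi].
Qed.

(** A morphism with image inside [<a>] is automatically onto [<a>] as soon as it
    reaches [a], because its image is a subsemiring and [<a>] is the least one
    containing [a]. *)
Lemma monogenic_iso_of_embedding (T : semiringType) (e : T -> S) :
    injective e ->
    {morph e : x y / (x + y)%R >-> (x + y)%R} ->
    {morph e : x y / (x * y)%g >-> (x * y)%g} ->
    (forall t, monogenic a (e t)) -> (exists t, e t = a) ->
  semiring_iso (monogenic_sr a) T.
Proof.
move=> einj eD eM eA [t0 et0].
have esurj (x : monogenic_sr a) : exists t, e t = val x.
  have := set_mem (valP x) (range e); case=> [|t _ <-]; last by exists t.
  split; last by move=> _ ->; exists t0.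
  split=> _ _ [x1 _ <-] [x2 _ <-]; first by exists (x1 + x2)%R; rewrite ?eD.
  by exists (x1 * x2)%g; rewrite ?eM.
have [f fE] := choice esurj.
exists f; split=> [|x y|x y]; last 2 first.
- by apply: einj; rewrite eD !fE.
- by apply: einj; rewrite eM !fE.
exists (fun t => exist _ (e t) (mem_set (eA t))) => [x|t].
  by apply: val_inj; rewrite /= fE.
by apply: einj; rewrite fE.
Qed.

Lemma sr_pow_stable m i : 0 < m -> p m = p m.+1 -> m <= i -> p i = p m.
Proof.
move=> m0 pm /subnKC <-; elim: (i - m) => [|d IHd]; first by rewrite addn0.
by rewrite addnS sr_powS ?IHd -?sr_powS // addn_gt0 m0.
Qed.

(** The one consequence of monotonicity that governs coincidences between
    powers; it is shared by the increasing and the decreasing case. *)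
Definition collapsing :=
  forall m n, 0 < m < n -> p m = p n -> p m = p m.+1.

Lemma collapsing_inj_below m : collapsing ->
    (forall i, 0 < i < m -> p i <> p i.+1) ->
  forall i j, 0 < i <= m -> 0 < j <= m -> p i = p j -> i = j.
Proof.
move=> clp neq i j hi hj pij.
have [ij|ji|//] := ltngtP i j.
  by case: (neq i); [lia|apply: clp pij; lia].
by case: (neq j); [lia|apply: (clp j i) => //; lia].
Qed.

Lemma infinite_order_inj : collapsing -> has_infinite_order a ->
  forall i j, 0 < i -> 0 < j -> p i = p j -> i = j.
Proof.
move=> clp infa i j i0 j0.
apply: (@collapsing_inj_below (maxn i j)) => //; try lia.
move=> m hm pm; apply: infa.
apply: (@sub_finite_set _ _ (p @` `I_m.+1)); last exact: finite_image.
move=> _ [n n0 <-] /=.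
have [nm|mn] := leqP n m; first by exists n.
by exists m => //; rewrite (@sr_pow_stable m n) //; lia.
Qed.

Lemma card_sr_pow m :
    (forall i j, 0 < i <= m -> 0 < j <= m -> p i = p j -> i = j) ->
  (p \o succn) @` `I_m #= `I_m.
Proof.
move=> pinj; apply: inj_card_eq => i j; rewrite !inE => im jm pij.
by have [] := pinj i.+1 j.+1 im jm pij.
Qed.

(** The power sequence of an element of order [k] must repeat, since otherwise
    its first [k.+1] terms would be too many; it then takes exactly [m] values,
    where [m] is the first index with [a^m = a^m.+1], whence [m = k]. *)
Lemma finite_order_pow k : collapsing -> has_order a k ->
  (forall i, 0 < i -> p i = p (minn i k)) /\
  (forall i j, 0 < i <= k -> 0 < j <= k -> p i = p j -> i = j).
Proof.
move=> clp ordk.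
have rep : exists m, (0 < m) && (p m == p m.+1).
  apply: contrapT => norep; suff : k.+1 <= k by rewrite ltnn.
  have pinj := @collapsing_inj_below k.+1 clp.
  rewrite -card_le_II -(card_le_eql (card_sr_pow (pinj _))); last first.
    by move=> i hi pi; apply: norep; exists i; rewrite pi eqxx andbT; lia.
  rewrite -(card_le_eqr ordk); apply: subset_card_le => _ [i _ <-].
  by exists i.+1.
case: (ex_minnP rep) => m /andP[m0 /eqP pm] mmin.
have pinj := @collapsing_inj_below m clp.
have {}pinj : forall i j, 0 < i <= m -> 0 < j <= m -> p i = p j -> i = j.
  apply: pinj => i hi pi; suff : m <= i by lia.
  by apply: mmin; rewrite pi eqxx andbT; lia.
have pmin i : 0 < i -> p i = p (minn i m).
  move=> i0; have [im|mi] := leqP i m; first by [].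
  by apply: sr_pow_stable => //; lia.
suff <- : m = k by [].
apply/card_eq_II; apply: card_eq_trans ordk.
apply: card_eq_trans (card_esym (card_sr_pow pinj)) _.
rewrite (_ : (p \o succn) @` `I_m = powers a) ?card_eqxx //.
apply/seteqP; split=> [_ [i im <-]|_ [i i0 <-]]; first by exists i.+1.
have im0 : 0 < minn i m by rewrite leq_min i0.
exists (minn i m).-1; first by rewrite /= prednK // geq_minr.
by rewrite [RHS]pmin // -[in RHS](prednK im0).
Qed.

(** Multiplying the comparison of [a] with [a^2] by [a] compares any two
    consecutive powers. [R] is kept general so as to be taken both as [<=] and
    as its converse. *)
Lemma sr_pow_homo (R : S -> S -> Prop) :
    (forall x, R x x) -> (forall y x z, R x y -> R y z -> R x z) ->
    (forall z x y, R x y -> R (z * x)%g (z * y)%g) ->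
    R a (p 2) ->
  forall i j, 0 < i <= j -> R (p i) (p j).
Proof.
move=> Rxx Rtr RM Ra.
have RS i : 0 < i -> R (p i) (p i.+1).
  elim: i => // -[|i] IHi _ //.
  by rewrite (@sr_powS i.+1) // (@sr_powS i.+2) //; apply/RM/IHi.
move=> i j /andP[i0 /subnKC <-].
elim: (j - i) => [|d IHd]; first by rewrite addn0.
by rewrite addnS; apply: Rtr IHd (RS _ _); lia.
Qed.

Lemma collapsing_of_order (R : S -> S -> Prop) :
    (forall x y, R x y -> R y x -> x = y) ->
    (forall i j, 0 < i <= j -> R (p i) (p j)) ->
  collapsing.
Proof.
move=> Ranti Rp m n mn pmn; apply: Ranti; first by apply: Rp; lia.
by rewrite pmn; apply: Rp; lia.
Qed.

End Powers.

Section Order.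
Variables (S : semiringType) (bipS : bipotent S).
Implicit Types x y z : S.

Lemma sr_le_refl x : sr_le x x.
Proof. by have [] := bipS x x. Qed.

Lemma sr_le_trans y x z : sr_le x y -> sr_le y z -> sr_le x z.
Proof. by rewrite /sr_le => xy <-; rewrite Algebra.addrA xy. Qed.

Lemma sr_le_anti x y : sr_le x y -> sr_le y x -> x = y.
Proof. by rewrite /sr_le Algebra.addrC => -> . Qed.

Lemma sr_le_mul z x y : sr_le x y -> sr_le (z * x)%g (z * y)%g.
Proof. by rewrite /sr_le -semiring_mulDr => ->. Qed.

Variable a : S.
Local Notation p := (sr_pow a).

Lemma sr_pow_le i j : sr_le a (p 2) -> 0 < i <= j -> sr_le (p i) (p j).
Proof.
move=> le12; apply: (sr_pow_homo (R := @sr_le S)) => //.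
- exact: sr_le_refl.
- exact: sr_le_trans.
- exact: sr_le_mul.
Qed.

Lemma sr_pow_ge i j : sr_le (p 2) a -> 0 < i <= j -> sr_le (p j) (p i).
Proof.
move=> le21; apply: (sr_pow_homo (R := fun x y => sr_le y x)) => //.
- exact: sr_le_refl.
- by move=> y x z yx zy; exact: sr_le_trans zy yx.
- by move=> z x y; exact: sr_le_mul.
Qed.

Lemma sr_pow_add_max i j : sr_le a (p 2) -> 0 < i -> 0 < j ->
  (p i + p j)%R = p (maxn i j).
Proof.
move=> le12 i0 j0; have [ij|ji] := leqP i j; first by apply: (sr_pow_le le12); lia.
by rewrite Algebra.addrC; apply: (sr_pow_le le12); lia.
Qed.

Lemma sr_pow_add_min i j : sr_le (p 2) a -> 0 < i -> 0 < j ->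
  (p i + p j)%R = p (minn i j).
Proof.
move=> le21 i0 j0; have [ij|ji] := leqP i j; last by apply: (sr_pow_ge le21); lia.
by rewrite Algebra.addrC; apply: (sr_pow_ge le21); lia.
Qed.

Lemma collapsing_le : sr_le a (p 2) -> collapsing a.
Proof.
move=> le12; apply: (collapsing_of_order (R := @sr_le S)).
  exact: sr_le_anti.
by move=> i j; exact: sr_pow_le.
Qed.

Lemma collapsing_ge : sr_le (p 2) a -> collapsing a.
Proof.
move=> le21; apply: (collapsing_of_order (R := fun x y => sr_le y x)).
  by move=> x y yx xy; exact: sr_le_anti.
by move=> i j; exact: sr_pow_ge.
Qed.

Lemma monogenic_iso_Nmax : has_infinite_order a -> sr_le a (p 2) ->
  semiring_iso (monogenic_sr a) Nmax.
Proof.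
move=> infa le12.
have pinj := infinite_order_inj (collapsing_le le12) infa.
apply: (monogenic_iso_of_embedding (e := fun t : Nmax => p (val t))).
- by move=> [x hx] [y hy] /= /pinj xy; apply: val_inj; apply: xy.
- by move=> x y; rewrite sr_pow_add_max //; apply: valP.
- by move=> x y; rewrite -sr_powD //; apply: valP.
- by move=> x; apply: monogenic_pow; apply: valP.
- by exists (exist _ 1 isT).
Qed.

Lemma monogenic_iso_negNmax : has_infinite_order a -> sr_le (p 2) a ->
  semiring_iso (monogenic_sr a) negNmax.
Proof.
move=> infa le21.
have pinj := infinite_order_inj (collapsing_ge le21) infa.
apply: (monogenic_iso_of_embedding (e := fun t : negNmax => p `|val t|)).
- by move=> [x x0] [y y0] /= /pinj xy; apply: val_inj => /=; lia.
- move=> [x x0] [y y0] /=; rewrite sr_pow_add_min //; try lia.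
  by congr sr_pow; lia.
- move=> [x x0] [y y0] /=; rewrite -sr_powD //; try lia.
  by congr sr_pow; lia.
- by move=> [x x0] /=; apply: monogenic_pow; lia.
- by exists (exist _ (Negz 0) isT).
Qed.

Lemma monogenic_iso_segmax (k : posnat) : has_order a k -> sr_le a (p 2) ->
  semiring_iso (monogenic_sr a) (segmax k).
Proof.
move=> ordk le12.
have [pmin pinj] := finite_order_pow (collapsing_le le12) ordk.
have k0 : 0 < k := svalP k.
apply: (monogenic_iso_of_embedding (e := fun t : segmax k => p (val t))).
- by move=> [x hx] [y hy] /= /pinj xy; apply: val_inj; apply: xy.
- by move=> [x hx] [y hy] /=; rewrite sr_pow_add_max //; lia.
- by move=> [x hx] [y hy] /=; rewrite -pmin ?sr_powD //; lia.
- by move=> [x hx] /=; apply: monogenic_pow; lia.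
- have h1 : 0 < 1 <= k by [].
  by exists (exist _ 1 h1).
Qed.

Lemma monogenic_iso_negsegmax (k : posnat) : has_order a k -> sr_le (p 2) a ->
  semiring_iso (monogenic_sr a) (negsegmax k).
Proof.
move=> ordk le21.
have [pmin pinj] := finite_order_pow (collapsing_ge le21) ordk.
have k0 : 0 < k := svalP k.
apply: (monogenic_iso_of_embedding (e := fun t : negsegmax k => p `|val t|)).
- by move=> [x hx] [y hy] /= /pinj xy; apply: val_inj => /=; lia.
- move=> [x hx] [y hy] /=; rewrite sr_pow_add_min //; try lia.
  by congr sr_pow; lia.
- move=> [x hx] [y hy] /=.
  have [x0 y0] : 0 < `|x| /\ 0 < `|y| by lia.
  rewrite -sr_powD // (pmin (`|x| + `|y|)) ?addn_gt0 ?x0 //.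
  by congr sr_pow; lia.
- by move=> [x hx] /=; apply: monogenic_pow; lia.
- have h1 : (- k%:Z <= Negz 0 < 0)%R by lia.
  by exists (exist _ (Negz 0) h1).
Qed.

End Order.

Theorem lemma1p3 (S : semiringType) (bipS : bipotent S) (a : S) :
  [/\ has_infinite_order a -> sr_lt a (sr_pow a 2) ->
        semiring_iso (monogenic_sr a) Nmax,
      has_infinite_order a -> sr_lt (sr_pow a 2) a ->
        semiring_iso (monogenic_sr a) negNmax,
      forall k : posnat, has_order a k -> sr_le a (sr_pow a 2) ->
        semiring_iso (monogenic_sr a) (segmax k) &
      forall k : posnat, has_order a k -> sr_le (sr_pow a 2) a ->
        semiring_iso (monogenic_sr a) (negsegmax k)].
Proof.
split.
- by move=> infa [le12 _]; exact: monogenic_iso_Nmax.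
- by move=> infa [le21 _]; exact: monogenic_iso_negNmax.
- by move=> k; exact: monogenic_iso_segmax.
- by move=> k; exact: monogenic_iso_negsegmax.
Qed.
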